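(* Let $L,M,N$ be positive integers, let $g:=\{g_l\}_{l\in\mathbb{N}_L}\subset \ell^2(\mathbb{Z}\times\mathbb{Z},\mathbb{R})$, and let $0<A\le B<\infty$. Then the following statements are equivalent: 1. $\mathcal{G}(g,L,M,N)$ is a frame for $\ell^2(\mathbb{Z}\times\mathbb{Z},\mathbb{H})$ with frame bounds $A\le B$. 2. For all $k\in\mathbb{Z}^2$, $$\frac{A}{M^2}I\preceq \sum_{l\in\mathbb{N}_L}\mathcal{M}_{g_l}(k)\mathcal{M}_{g_l}^t(k)\preceq\frac{B}{M^2}I.$$ 3. For all $k\in\mathbb{N}_N^2$, $$\frac{A}{M^2}I\preceq \sum_{l\in\mathbb{N}_L}\mathcal{M}_{g_l}(k)\mathcal{M}_{g_l}^t(k)\preceq\frac{B}{M^2}I.$$ Here $I=(\delta_{p,n})_{p,n\in\mathbb{Z}^2}$ is the identity matrix.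
   Context: $\mathbb{H}$ is the algebra of real quaternions with imaginary units $i,j,ij$. For a positive integer $K$, $\mathbb{N}_K:=\{0,1,\dots,K-1\}$. $\ell^2(\mathbb{Z}\times\mathbb{Z},\mathbb{H})$ is the right quaternionic Hilbert space of functions $f:\mathbb{Z}^2\to\mathbb{H}$ with $\sum_{k\in\mathbb{Z}^2}|f(k)|^2<\infty$, with inner product $\langle f,g\rangle=\sum_{k\in\mathbb{Z}^2}\overline{f(k)}\,g(k)$; $\ell^2(\mathbb{Z}\times\mathbb{Z},\mathbb{R})$ is the subset of real-valued ones. For $n\in\mathbb{Z}^2$, $(T_{nN}f)(k)=f(k-nN)$ where $nN=(n_1N,n_2N)$. For $m=(m_1,m_2)\in\mathbb{N}_M^2$, $(E_{\frac mM}f)(k)=e^{2\pi i\frac{m_1}{M}k_1}f(k)e^{2\pi j\frac{m_2}{M}k_2}$, $k=(k_1,k_2)\in\mathbb{Z}^2$. The Gabor system is $\mathcal{G}(g,L,M,N):=\{E_{\frac mM}T_{nN}g_l\}_{l\in\mathbb{N}_L,\,m\in\mathbb{N}_M^2,\,n\in\mathbb{Z}^2}$. It is a frame with frame bounds $A\le B$ (where $0<A\le B<\infty$) if for all $h\in\ell^2(\mathbb{Z}\times\mathbb{Z},\mathbb{H})$: $A\|h\|^2\le\sum_{l\in\mathbb{N}_L}\sum_{n\in\mathbb{Z}^2}\sum_{m\in\mathbb{N}_M^2}|\langle E_{\frac mM}T_{nN}g_l,h\rangle|^2\le B\|h\|^2$. For $h\in\ell^2(\mathbb{Z}\times\mathbb{Z},\mathbb{H})$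 and $k\in\mathbb{Z}^2$, $\mathcal{M}_h(k)$ is the matrix indexed by $\mathbb{Z}^2\times\mathbb{Z}^2$ with entries $(\mathcal{M}_h(k))_{p,n}=h(k+pM-nN)$, $p,n\in\mathbb{Z}^2$; $^t$ denotes transpose. The inequalities $\preceq$ are meant in the sense of quadratic forms on $\ell^2(\mathbb{Z}\times\mathbb{Z},\mathbb{H})$: $\frac{A}{M^2}I\preceq \sum_{l}\mathcal{M}_{g_l}(k)\mathcal{M}_{g_l}^t(k)\preceq\frac{B}{M^2}I$ means that for all $x\in\ell^2(\mathbb{Z}\times\mathbb{Z},\mathbb{H})$, $\frac{A}{M^2}\|x\|^2\le\sum_{l\in\mathbb{N}_L}\|\mathcal{M}_{g_l}^t(k)x\|^2\le\frac{B}{M^2}\|x\|^2$, where $(\mathcal{M}_{g_l}^t(k)x)_n=\sum_{p\in\mathbb{Z}^2}g_l(k+pM-nN)\,x(p)$. *)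

(* Defs.v *)
From HB Require Import structures.
From mathcomp Require Import all_boot all_order all_algebra.
From mathcomp Require Import ring.
From mathcomp Require Import all_classical all_reals all_analysis.

Set Implicit Arguments.
Unset Strict Implicit.
Unset Printing Implicit Defensive.
Import Order.TTheory GRing.Theory Num.Theory.
Local Open Scope classical_set_scope.
Local Open Scope ring_scope.

(* [Quat a b c d] is the quaternion a + b i + c j + d ij. *)
Record quat (R : Type) := Quat { q1 : R; qi : R; qj : R; qij : R }.

Section QuatRing.
Variable R : comNzRingType.
Implicit Types x y z : quat R.

Definition quat_tuple x := (q1 x, qi x, qj x, qij x).
Definition tuple_quat (t : R * R * R * R) : quat R :=
  let: (a, b, c, d) := t in Quat a b c d.
Lemma quat_tupleK : cancel quat_tuple tuple_quat. Proof. by case. Qed.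

HB.instance Definition _ := Choice.copy (quat R) (can_type quat_tupleK).

Definition quat_add x y :=
  Quat (q1 x + q1 y) (qi x + qi y) (qj x + qj y) (qij x + qij y).
Definition quat_opp x := Quat (- q1 x) (- qi x) (- qj x) (- qij x).

Lemma quat_addA : associative quat_add.
Proof. by move=> x y z; rewrite /quat_add /= !addrA. Qed.
Lemma quat_addC : commutative quat_add.
Proof. by move=> x y; congr Quat; rewrite addrC. Qed.
Lemma quat_add0 : left_id (Quat 0 0 0 0) quat_add.
Proof. by case=> a b c d; rewrite /quat_add /= !add0r. Qed.
Lemma quat_addN : left_inverse (Quat 0 0 0 0) quat_opp quat_add.
Proof. by case=> a b c d; rewrite /quat_add /= !addNr. Qed.

HB.instance Definition _ :=
  GRing.isZmodule.Build (quat R) quat_addA quat_addC quat_add0 quat_addN.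

Definition quat_mul x y := Quat
  (q1 x * q1 y - qi x * qi y - qj x * qj y - qij x * qij y)
  (q1 x * qi y + qi x * q1 y + qj x * qij y - qij x * qj y)
  (q1 x * qj y - qi x * qij y + qj x * q1 y + qij x * qi y)
  (q1 x * qij y + qi x * qj y - qj x * qi y + qij x * q1 y).

Lemma quat_mulA : associative quat_mul.
Proof. by move=> x y z; congr Quat => /=; ring. Qed.
Lemma quat_mul1l : left_id (Quat 1 0 0 0) quat_mul.
Proof. by case=> a b c d; congr Quat => /=; ring. Qed.
Lemma quat_mul1r : right_id (Quat 1 0 0 0) quat_mul.
Proof. by case=> a b c d; congr Quat => /=; ring. Qed.
Lemma quat_mulDl : left_distributive quat_mul +%R.
Proof. by move=> x y z; congr Quat => /=; ring. Qed.
Lemma quat_mulDr : right_distributive quat_mul +%R.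
Proof. by move=> x y z; congr Quat => /=; ring. Qed.
Lemma quat_oner_neq0 : Quat 1 0 0 0 != 0 :> quat R.
Proof. by apply/eqP => -[] /eqP; rewrite oner_eq0. Qed.

HB.instance Definition _ := GRing.Zmodule_isNzRing.Build (quat R)
  quat_mulA quat_mul1l quat_mul1r quat_mulDl quat_mulDr quat_oner_neq0.

Definition quatR (r : R) : quat R := Quat r 0 0 0.
Definition quatI : quat R := Quat 0 1 0 0.
Definition quatJ : quat R := Quat 0 0 1 0.

Definition quat_conj x := Quat (q1 x) (- qi x) (- qj x) (- qij x).

Lemma quatII : quatI * quatI = -1.
Proof. by congr Quat => /=; ring. Qed.
Lemma quatJJ : quatJ * quatJ = -1.
Proof. by congr Quat => /=; ring. Qed.
Lemma quatIJ : quatI * quatJ = Quat 0 0 0 1.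
Proof. by congr Quat => /=; ring. Qed.
Lemma quatJI : quatJ * quatI = - (quatI * quatJ).
Proof. by congr Quat => /=; ring. Qed.
End QuatRing.

Notation Z2 := (int * int)%type.

Section Gabor.
Variable R : realType.
Local Notation H := (quat R).
Implicit Types (f g h x : Z2 -> H).

Definition quat_abs (q : H) : R :=
  Num.sqrt (q1 q ^+ 2 + qi q ^+ 2 + qj q ^+ 2 + qij q ^+ 2).

(* Euler's formula for e^{u t}, where u is an imaginary unit (u * u = -1) *)
Definition quat_expi (u : H) (t : R) : H := quatR (cos t) + u * quatR (sin t).

(* Unordered sum over Z^2, componentwise for quaternions. It is meaningful for
   absolutely summable families, such as products of two l^2 functions. *)
Definition sumZ2 (u : Z2 -> R) : R :=
  fine (\esum_(k in [set: Z2]) ((EFin \o u)^\+ k) -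
        \esum_(k in [set: Z2]) ((EFin \o u)^\- k))%E.

Definition quat_sumZ2 f : H :=
  Quat (sumZ2 (@q1 R \o f)) (sumZ2 (@qi R \o f))
       (sumZ2 (@qj R \o f)) (sumZ2 (@qij R \o f)).

(* the square of the l^2 norm, possibly +oo *)
Definition sqnorm f : \bar R :=
  (\esum_(k in [set: Z2]) (quat_abs (f k) ^+ 2)%:E)%E.

Definition ell2 : set (Z2 -> H) := [set f | (sqnorm f < +oo)%E].

Definition ell2_real : set (Z2 -> H) :=
  [set f | ell2 f /\ forall k, exists r : R, f k = quatR r].

Definition inner f g : H := quat_sumZ2 (fun k => quat_conj (f k) * g k).

Definition translate (N : nat) (n : Z2) f : Z2 -> H := fun k => f (k - n *+ N).

Definition modulate (M : nat) (m : 'I_M * 'I_M) f : Z2 -> H := fun k =>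
  quat_expi (quatI R) (2 * pi * (m.1%:R / M%:R) * k.1%:~R) * f k *
  quat_expi (quatJ R) (2 * pi * (m.2%:R / M%:R) * k.2%:~R).

Definition gabor (L M N : nat) (g : 'I_L -> Z2 -> H)
    (l : 'I_L) (m : 'I_M * 'I_M) (n : Z2) : Z2 -> H :=
  modulate m (translate N n (g l)).

Definition gabor_frame (L M N : nat) (g : 'I_L -> Z2 -> H) (A B : R) : Prop :=
  [/\ 0 < A, A <= B & forall h, ell2 h ->
    let S := (\sum_(l < L) \esum_(n in [set: Z2]) \sum_(m : 'I_M * 'I_M)
                (quat_abs (inner (gabor N g l m n) h) ^+ 2)%:E)%E in
    (A%:E * sqnorm h <= S)%E /\ (S <= B%:E * sqnorm h)%E].

(* [a p n] is the entry in row p and column n. *)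
Definition Z2matrix := Z2 -> Z2 -> H.

Definition Z2tr (a : Z2matrix) : Z2matrix := fun p n => a n p.

Definition Z2apply (a : Z2matrix) x : Z2 -> H :=
  fun p => quat_sumZ2 (fun n => a p n * x n).

Definition gabor_mx (M N : nat) h (k : Z2) : Z2matrix :=
  fun p n => h (k + p *+ M - n *+ N).

(* a I <= \sum_l (C l) (C l)^t <= b I in the sense of quadratic forms, for
   matrices C l with real entries; the middle form at x is \sum_l |(C l)^t x|^2 *)
Definition gram_bounds (L : nat) (C : 'I_L -> Z2matrix) (a b : R) : Prop :=
  forall x, ell2 x ->
    let S := (\sum_(l < L) sqnorm (Z2apply (Z2tr (C l)) x))%E in
    (a%:E * sqnorm x <= S)%E /\ (S <= b%:E * sqnorm x)%E.
End Gabor.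

(* Main.v *)
Require Import Defs.
From mathcomp Require Import all_boot all_order all_algebra.
From mathcomp Require Import ring lra.
From mathcomp Require Import all_classical all_reals all_analysis.
Import Order.TTheory GRing.Theory Num.Theory.
Local Open Scope classical_set_scope.
Local Open Scope ring_scope.

(* Fix k0 in Z^2 and write every k in Z^2 as k0 + r + pM with r in N_M^2. The
   windows are real and the modulations are M-periodic, so the inner product of
   h with the (l, m, n) Gabor atom is the two-sided quaternionic Fourier
   transform over N_M^2, at frequency m, of
     r |-> (M_{g_l}^t(k0 + r) h_r)_n, where h_r(p) = h(k0 + r + pM).
   Applying Parseval once for j and once for i, the frame sum of h equals M^2
   times the sum over r of the Gram forms at k0 + r evaluated at h_r.
   Functions h supported on a single coset k + M Z^2 give 1 => 2, and summing
   over r gives 2 => 1. Finally the Gram form is N-periodic in k, since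
   replacing k by k + qN only shifts the column index n. *)

(** * Unordered sums over Z^2: linearity, and splitting along the cosets of M Z^2 *)

Section Sums.
Context {R : realType}.

(** An unordered sum is a supremum of finite subsums, and scaling by a nonnegative real commutes
    with both operations. *)
Lemma esumZl (T : choiceType) (D : set T) (c : R) (a : T -> \bar R) :
  0 <= c -> (forall k, D k -> 0 <= a k)%E ->
  (\esum_(k in D) (c%:E * a k) = c%:E * \esum_(k in D) a k)%E.
Proof.
move=> c0 a0; rewrite /esum -ereal_supZl//; last first.
  by apply/set0P; eexists; exists set0 => //; exact: fsets_set0.
have distr X : fsets D X ->
    (c%:E * \sum_(x \in X) a x = \sum_(x \in X) (c%:E * a x))%E.
  move=> [finX XD]; rewrite !fsbig_finite//= !big_seq ge0_sume_distrr// => i.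
  by rewrite in_fset_set// inE => /XD/a0.
congr ereal_sup; apply/seteqP; split=> [_ [X [finX XD] <-]|_ [_ [X [finX XD] <-] <-]] /=.
  exists (\sum_(x \in X) a x)%E; first by exists X.
  by rewrite distr//; split.
by exists X => //; rewrite distr//; split.
Qed.

Lemma esum_finType (I : finType) (a : I -> \bar R) :
  (forall i, 0 <= a i)%E -> (\esum_(i in [set: I]) a i = \sum_i a i)%E.
Proof.
move=> a0; rewrite esum_fset//; last exact: finite_finset.
rewrite (bigfs _ (r := index_enum I) (P := xpredT))//; first last.
- by move=> i _; rewrite mem_index_enum.
- exact: index_enum_uniq.
by apply: eq_fsbigl; apply/seteqP; split.
Qed.

Definition summableZ2 (u : Z2 -> R) := summable [set: Z2] (EFin \o u).

Lemma summableZ2E u : summableZ2 u = (\esum_(k in [set: Z2]) `|u k|%:E < +oo)%E.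
Proof. by []. Qed.

Lemma le_summableZ2 {u v} : (forall k, `|u k| <= `|v k|) -> summableZ2 v -> summableZ2 u.
Proof.
rewrite !summableZ2E => uv; apply: le_lt_trans; apply: le_esum => k _.
by rewrite lee_fin.
Qed.

Lemma summableZ2D u v : summableZ2 u -> summableZ2 v -> summableZ2 (u \+ v).
Proof. exact: summableD. Qed.

Lemma summableZ2Z c u : summableZ2 u -> summableZ2 (fun k => c * u k).
Proof.
rewrite !summableZ2E => su.
under eq_esum do rewrite normrM EFinM.
by rewrite esumZl// lte_mul_pinfty// lee_fin.
Qed.

Lemma summableZ2_fin_num u : (forall k, 0 <= u k) -> summableZ2 u ->
  \esum_(k in [set: Z2]) (u k)%:E \is a fin_num.
Proof.
move=> u0; rewrite /summableZ2 summableE /=.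
by under eq_esum do rewrite ger0_norm//.
Qed.

(** Any splitting into nonnegative summable functions computes [sumZ2], not only the one into
    positive and negative parts. This reduces linearity to nonnegative sums. *)
Lemma sumZ2B u v : (forall k, 0 <= u k) -> (forall k, 0 <= v k) ->
  summableZ2 u -> summableZ2 v -> sumZ2 (u \- v) =
  fine (\esum_(k in [set: Z2]) (u k)%:E) - fine (\esum_(k in [set: Z2]) (v k)%:E).
Proof.
move=> u0 v0 su sv.
rewrite /sumZ2 -[EFin \o _]/((EFin \o u) \- (EFin \o v))%E esumB//.
- by rewrite fineB// summableZ2_fin_num.
- by move=> k _; rewrite lee_fin.
- by move=> k _; rewrite lee_fin.
Qed.

Lemma summableZ2_posneg u : summableZ2 u -> exists a b : Z2 -> R,
  [/\ forall k, 0 <= a k, forall k, 0 <= b k, summableZ2 a, summableZ2 b & u = a \- b].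
Proof.
move=> su.
have [sa sb] : summableZ2 (fun k => `|u k|) /\ summableZ2 (fun k => `|u k| - u k).
  have sa : summableZ2 (fun k => `|u k|) by apply: le_summableZ2 su => k; rewrite normr_id.
  split=> //; apply: (@le_summableZ2 _ (fun k => 2 * `|u k|)); last exact: summableZ2Z.
  move=> k; rewrite [leRHS]ger0_norm ?mulr_ge0// (le_trans (ler_normB _ _))//.
  by rewrite normr_id mulr_natl.
(* The splitting is |u| - (|u| - u), whose second part is at most 2|u|. *)
exists (fun k => `|u k|), (fun k => `|u k| - u k); split=> //.
- by move=> k; rewrite subr_ge0 ler_norm.
- by apply/funext => k /=; rewrite opprB addrC subrK.
Qed.

Lemma fine_esumD u v : (forall k, 0 <= u k) -> (forall k, 0 <= v k) ->
  summableZ2 u -> summableZ2 v ->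
  fine (\esum_(k in [set: Z2]) (u k + v k)%:E) =
  fine (\esum_(k in [set: Z2]) (u k)%:E) + fine (\esum_(k in [set: Z2]) (v k)%:E).
Proof.
move=> u0 v0 su sv; rewrite -fineD ?summableZ2_fin_num// -esumD//.
- by move=> k _; rewrite lee_fin.
- by move=> k _; rewrite lee_fin.
Qed.

Lemma fine_esumZ c u : 0 <= c -> (forall k, 0 <= u k) ->
  summableZ2 u ->
  fine (\esum_(k in [set: Z2]) (c * u k)%:E) =
  c * fine (\esum_(k in [set: Z2]) (u k)%:E).
Proof.
move=> c0 u0 su; under eq_esum do rewrite EFinM.
rewrite esumZl// ?fineM// ?summableZ2_fin_num// => k _.
by rewrite lee_fin.
Qed.

Lemma sumZ2D u v : summableZ2 u -> summableZ2 v -> sumZ2 (u \+ v) = sumZ2 u + sumZ2 v.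
Proof.
move=> /summableZ2_posneg[a [b [a0 b0 sa sb ->]]] /summableZ2_posneg[c [d [c0 d0 sc sd ->]]].
have -> : (a \- b) \+ (c \- d) = (a \+ c) \- (b \+ d).
  by apply/funext => k /=; rewrite opprD addrACA.
rewrite !sumZ2B ?fine_esumD//; first by rewrite opprD addrACA.
- by move=> k; rewrite addr_ge0.
- by move=> k; rewrite addr_ge0.
- exact: summableZ2D.
- exact: summableZ2D.
Qed.

Lemma sumZ2Z c u : summableZ2 u -> sumZ2 (fun k => c * u k) = c * sumZ2 u.
Proof.
move=> /summableZ2_posneg[a [b [a0 b0 sa sb ->]]].
have [c0|/ltW c0] := leP 0 c.
  have -> : (fun k => c * (a \- b) k) = (fun k => c * a k) \- (fun k => c * b k).
    by apply/funext => k /=; rewrite mulrBr.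
  rewrite !sumZ2B ?fine_esumZ ?summableZ2Z -?mulrBr//.
  - by move=> k; rewrite mulr_ge0.
  - by move=> k; rewrite mulr_ge0.
(* For negative c the two parts trade places, with the nonnegative factor -c. *)
have nc0 : 0 <= - c by rewrite oppr_ge0.
have -> : (fun k => c * (a \- b) k) = (fun k => - c * b k) \- (fun k => - c * a k).
  by apply/funext => k /=; ring.
rewrite !sumZ2B ?fine_esumZ ?summableZ2Z//.
- by rewrite !mulNr opprK mulrBr addrC.
- by move=> k; rewrite mulr_ge0.
- by move=> k; rewrite mulr_ge0.
Qed.

(* The shift by k0 makes any coset k0 + M Z^2 the one of index (0, 0). *)
Definition residue {M : nat} (k0 : Z2) (r : 'I_M * 'I_M) : Z2 :=
  k0 + (r.1%:Z, r.2%:Z).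

Lemma residue_int {M : nat} (hM : (0 < M)%N) (z : int) :
  exists (r : 'I_M) (q : int), z = r%:Z + q *+ M.
Proof.
have M0 : M%:Z != 0 by rewrite intS_eq0 || (case: M hM).
have rlt : (`|(z %% M%:Z)%Z| < M)%N.
  by rewrite -ltz_nat gez0_abs ?modz_ge0// ltz_pmod//; case: M hM {M0}.
exists (Ordinal rlt), (z %/ M%:Z)%Z => /=.
by rewrite gez0_abs ?modz_ge0// addrC {1}(divz_eq z M%:Z) -mulr_natr natz.
Qed.

Lemma residue_int_inj {M : nat} {r s : 'I_M} {p q : int} :
  r%:Z + p *+ M = s%:Z + q *+ M -> r = s /\ p = q.
Proof.
have key (t : 'I_M) (x : int) : ((t%:Z + x *+ M) %% M%:Z)%Z = t%:Z.
  by rewrite addrC -mulr_natr natz modzMDl modz_small// ltz_nat ltn_ord.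
have M0 : M%:Z != 0 by case: M r {s key} => [[]|].
move=> e; have rs : r = s.
  by apply/val_inj; have := congr1 (modz^~ M%:Z) e; rewrite !key => -[].
split=> //; move: e; rewrite rs => /addrI.
by rewrite -[p *+ M]mulr_natr -[q *+ M]mulr_natr natz; apply: mulIf.
Qed.

Lemma mulrnZ2 (p : Z2) M : p *+ M = (p.1 *+ M, p.2 *+ M).
Proof. by elim: M => [//|M IH]; rewrite !mulrS IH. Qed.

(** Euclidean division by M of each coordinate of k - k0. *)
Lemma residue_bij {M : nat} (hM : (0 < M)%N) (k0 : Z2) :
  set_bij [set: ('I_M * 'I_M) * Z2] [set: Z2]
    (fun rp => residue k0 rp.1 + rp.2 *+ M).
Proof.
split=> //.
  move=> [[r1 r2] [p1 p2]] [[s1 s2] [q1 q2]] _ _ /=.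
  rewrite /residue -!addrA => /addrI; rewrite !mulrnZ2 /=.
  by case=> /residue_int_inj[-> ->] /residue_int_inj[-> ->].
move=> k _; have [r1 [x1 e1]] := residue_int hM (k - k0).1.
have [r2 [x2 e2]] := residue_int hM (k - k0).2.
exists ((r1, r2), (x1, x2)) => //=.
rewrite /residue -addrA mulrnZ2 -[RHS](subrK k0) addrC.
by rewrite [k - k0]surjective_pairing e1 e2.
Qed.

(** Reindexing by [residue_bij] gives a sum over pairs (r, p), which may be iterated because all
    terms are nonnegative. *)
Lemma esum_residue {M : nat} (hM : (0 < M)%N) (k0 : Z2) (a : Z2 -> \bar R) :
  (forall k, 0 <= a k)%E ->
  (\esum_(k in [set: Z2]) a k =
   \sum_(r : 'I_M * 'I_M) \esum_(p in [set: Z2]) a (residue k0 r + p *+ M)%R)%E.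
Proof.
move=> a0; rewrite (reindex_esum _ _ _ a (residue_bij hM k0)).
rewrite -esum_finType; last by move=> r; apply: esum_ge0.
by rewrite esum_esum//; congr esum; apply/seteqP; split.
Qed.

Lemma summableZ2_residue {M : nat} (hM : (0 < M)%N) (k0 : Z2) u (r : 'I_M * 'I_M) :
  summableZ2 u -> summableZ2 (fun p => u (residue k0 r + p *+ M)).
Proof.
rewrite !summableZ2E (esum_residue hM k0) => [|k]; last by rewrite lee_fin.
apply: le_lt_trans; rewrite (bigD1 r)//= leeDl// sume_ge0// => s _.
exact: esum_ge0.
Qed.

Lemma sumZ2_residue {M : nat} (hM : (0 < M)%N) (k0 : Z2) u : summableZ2 u ->
  sumZ2 u = \sum_(r : 'I_M * 'I_M) sumZ2 (fun p => u (residue k0 r + p *+ M)).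
Proof.
have split_fine a : (forall k, 0 <= a k) -> summableZ2 a ->
    fine (\esum_(k in [set: Z2]) (a k)%:E) =
    \sum_(r : 'I_M * 'I_M) fine (\esum_(p in [set: Z2]) (a (residue k0 r + p *+ M))%:E).
  move=> a0 sa; rewrite (esum_residue hM k0) => [|k]; last by rewrite lee_fin.
  rewrite sum_fine// => r _.
  exact: (summableZ2_fin_num (fun p => a (residue k0 r + p *+ M))) (summableZ2_residue hM _ _ _ _).
move=> /summableZ2_posneg[a [b [a0 b0 sa sb ->]]].
rewrite sumZ2B// !split_fine// -sumrB.
by apply: eq_bigr => r _; rewrite -sumZ2B// summableZ2_residue.
Qed.
End Sums.

(** * Periodicity of cosine and sine, and orthogonality of the M-th roots of unity *)

Section Trig.
Context {R : realType}.

Lemma cosD2piz (x : R) (z : int) : cos (x + 2 * pi * z%:~R) = cos x.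
Proof.
have nat_case y n : cos (y + 2 * pi * n%:R) = cos y :> R.
  by rewrite mulr_natr mulr_natl (periodicn (@cosD2pi R)).
case: z => n; first exact: nat_case.
by rewrite NegzE mulrNz -pmulrn -[in RHS](subrK (2 * pi * n.+1%:R) x) nat_case mulrN.
Qed.

Lemma sinD2piz (x : R) (z : int) : sin (x + 2 * pi * z%:~R) = sin x.
Proof.
have nat_case y n : sin (y + 2 * pi * n%:R) = sin y :> R.
  by rewrite mulr_natr mulr_natl (periodicn (@sinD2pi R)).
case: z => n; first exact: nat_case.
by rewrite NegzE mulrNz -pmulrn -[in RHS](subrK (2 * pi * n.+1%:R) x) nat_case mulrN.
Qed.

(* The two sums are the coordinates of a vector fixed by the rotation of
   angle x, which is not the identity. *)
Lemma sum_cos_sin (M : nat) (x : R) :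
  cos x != 1 -> cos (x *+ M) = 1 -> sin (x *+ M) = 0 ->
  \sum_(m < M) cos (x *+ m) = 0 /\ \sum_(m < M) sin (x *+ m) = 0.
Proof.
move=> x1 cM sM.
(* The orbit closes up after M steps, so advancing the index by one leaves the sum unchanged; the
   addition formulas then express this as invariance under the rotation. *)
have shift (f : nat -> R) : f M = f 0%N -> \sum_(m < M) f m.+1 = \sum_(m < M) f m.
  move=> fM; have e : \sum_(i < M.+1) f i = \sum_(m < M) f m + f M.
    by rewrite big_ord_recr.
  by move: e; rewrite big_ord_recl fM addrC => /addIr.
have := shift (fun m => cos (x *+ m)); have := shift (fun m => sin (x *+ m)).
rewrite !mulr0n cos0 sin0 => /(_ sM) + /(_ cM).
under eq_bigr do rewrite mulrS sinD.
under [in X in _ -> X -> _]eq_bigr do rewrite mulrS cosD.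
rewrite big_split sumrB -!mulr_sumr /=.
set C := \sum_(m < M) cos _; set S := \sum_(m < M) sin _ => eS eC.
(* This is the determinant of the rotation minus the identity; the two coordinates are then
   eliminated by Cramer's rule. *)
have d0 : (cos x - 1) ^+ 2 + sin x ^+ 2 != 0.
  rewrite paddr_eq0 ?sqr_ge0// negb_and; apply/orP; left.
  by rewrite expf_eq0 /= subr_eq0.
split; apply: (mulfI d0); rewrite mulr0.
  have -> : ((cos x - 1) ^+ 2 + sin x ^+ 2) * C =
    (cos x - 1) * (cos x * C - sin x * S - C) +
    sin x * (sin x * C + cos x * S - S) by ring.
  by rewrite eS eC !subrr !mulr0 addr0.
have -> : ((cos x - 1) ^+ 2 + sin x ^+ 2) * S =
  (cos x - 1) * (sin x * C + cos x * S - S) -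
  sin x * (cos x * C - sin x * S - C) by ring.
by rewrite eS eC !subrr !mulr0 subr0.
Qed.

(** Since cosine is even, s < r may be assumed. Then the half angle y lies strictly between 0 and
    pi, so sin y > 0 and cos (2y) = 1 - 2 sin^2 y differs from 1. *)
Lemma cos_root_neq1 (M : nat) (r s : 'I_M) : r != s ->
  cos (2 * pi * ((r%:R - s%:R) / M%:R)) != 1 :> R.
Proof.
wlog : r s / (s < r)%N.
  move=> H rs; have [r_s|s_r|/val_inj e] := ltngtP r s; last by rewrite e eqxx in rs.
    by rewrite -cosN -mulrN -mulNr opprB H// eq_sym.
  exact: H.
move=> sr _.
have M0 : 0 < M%:R :> R by rewrite ltr0n; case: M r {s sr} => [[]|].
set y : R := pi * ((r%:R - s%:R) / M%:R).
have -> : 2 * pi * ((r%:R - s%:R) / M%:R) = y + y :> R by rewrite /y; ring.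
have sy : 0 < sin y.
  apply: sin_gt0_pi; rewrite /y mulr_gt0 ?pi_gt0 ?divr_gt0 ?subr_gt0 ?ltr_nat//=.
  rewrite gtr_pMr ?pi_gt0// ltr_pdivrMr// mul1r (le_lt_trans (_ : _ <= r%:R))//.
    by rewrite gerBl.
  by rewrite ltr_nat.
rewrite cosD -!expr2 cos2sin2; apply/negP => /eqP e.
have : sin y ^+ 2 = 0 by lra.
by move/eqP; rewrite expf_eq0/= gt_eqF.
Qed.

(** Orthogonality of the characters of Z/M, in real and imaginary parts so that it applies to
    exponentials along any quaternionic imaginary unit. *)
Lemma sum_root (M : nat) (r s : 'I_M) :
  \sum_(m < M) cos (2 * pi * (m%:R / M%:R) * (r%:R - s%:R)) =
    M%:R *+ (r == s) :> R /\
  \sum_(m < M) sin (2 * pi * (m%:R / M%:R) * (r%:R - s%:R)) = 0 :> R.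
Proof.
have [->|rs] := eqVneq r s.
  split.
    under eq_bigr do rewrite subrr mulr0 cos0.
    by rewrite sumr_const card_ord.
  by rewrite big1// => m _; rewrite subrr mulr0 sin0.
have M0 : M%:R != 0 :> R by rewrite pnatr_eq0; case: M r {s rs} => [[]|].
set x : R := 2 * pi * ((r%:R - s%:R) / M%:R).
have angle n : 2 * pi * (n%:R / M%:R) * (r%:R - s%:R) = x *+ n.
  by rewrite -mulr_natr /x; ring.
under eq_bigr do rewrite angle.
under [X in _ /\ X = _]eq_bigr do rewrite angle.
have xM : x *+ M = 0 + 2 * pi * (r%:Z - s%:Z)%:~R.
  by rewrite -angle divff// mulr1 add0r rmorphB.
apply: sum_cos_sin; first exact: cos_root_neq1.
  by rewrite xM cosD2piz cos0.
by rewrite xM sinD2piz sin0.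
Qed.
End Trig.

(** * Quaternionic exponentials and the two-sided Parseval identity over N_M^2 *)

Section Quat.
Context {R : realType}.
Implicit Types x y z u : quat R.

(** The Euclidean inner product of R^4, that is, the real part of conj(x) y. Being real bilinear, it
    expands the square of a sum without any commutation of quaternions. *)
Definition qdot x y := q1 x * q1 y + qi x * qi y + qj x * qj y + qij x * qij y.

Lemma qdotC x y : qdot x y = qdot y x.
Proof. by rewrite /qdot; ring. Qed.

Lemma qdotDr x y z : qdot x (y + z) = qdot x y + qdot x z.
Proof. by rewrite /qdot /=; ring. Qed.

Lemma qdot_sumr I (s : seq I) x (f : I -> quat R) :
  qdot x (\sum_(i <- s) f i) = \sum_(i <- s) qdot x (f i).
Proof.
apply: (big_morph (qdot x) (qdotDr x)).
by rewrite /qdot /= !mulr0 !addr0.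
Qed.

Lemma qdot_suml I (s : seq I) y (f : I -> quat R) :
  qdot (\sum_(i <- s) f i) y = \sum_(i <- s) qdot (f i) y.
Proof. by rewrite qdotC qdot_sumr; apply: eq_bigr => i _; rewrite qdotC. Qed.

Lemma quat_abs_sqr x : quat_abs x ^+ 2 = qdot x x.
Proof. by rewrite /quat_abs sqr_sqrtr ?addr_ge0 ?sqr_ge0. Qed.

Lemma quat_abs_ge0 x : 0 <= quat_abs x. Proof. exact: sqrtr_ge0. Qed.

(** Euler's four-square identity. *)
Lemma quat_absM x y : quat_abs (x * y) = quat_abs x * quat_abs y.
Proof.
rewrite /quat_abs -sqrtrM ?addr_ge0 ?sqr_ge0//.
by congr Num.sqrt => /=; ring.
Qed.

Lemma quat_abs_conj x : quat_abs (quat_conj x) = quat_abs x.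
Proof. by rewrite /quat_abs /= !sqrrN. Qed.

(** The square roots of -1, so that i and j are treated alike. *)
Definition qunit u := [/\ q1 u = 0 & qdot u u = 1].

Lemma qunitI : qunit (quatI R).
Proof. by split=> //; rewrite /qdot /=; ring. Qed.

Lemma qunitJ : qunit (quatJ R).
Proof. by split=> //; rewrite /qdot /=; ring. Qed.

(** Left multiplication by conj(p) has adjoint left multiplication by p, so the left side is the
    inner product of x with e^{u(a-b)} y. *)
Lemma qdot_rot u a b x y : qunit u ->
  qdot (quat_conj (quat_expi u a) * x) (quat_conj (quat_expi u b) * y) =
  cos (a - b) * qdot x y + sin (a - b) * qdot x (u * y).
Proof.
case: u => u1 ui uj uk [/= u10]; rewrite /qdot /= u10 cosB sinB => uu.
(* The factor multiplying sin a sin b is kept in the exact shape of [uu], which replaces it by 1. *)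
transitivity (cos a * cos b * (q1 x * q1 y + qi x * qi y + qj x * qj y + qij x * qij y) +
 (0 * 0 + ui * ui + uj * uj + uk * uk) * (sin a * sin b) *
  (q1 x * q1 y + qi x * qi y + qj x * qj y + qij x * qij y) +
 (sin a * cos b - cos a * sin b) * qdot x (Quat 0 ui uj uk * y)).
  by rewrite /qdot /=; ring.
by rewrite uu /qdot /=; ring.
Qed.

Lemma quat_abs_expi u t : qunit u -> quat_abs (quat_expi u t) = 1.
Proof.
move=> hu; apply: (pexpIrn (n := 2)) => //; rewrite ?nnegrE ?quat_abs_ge0//.
rewrite expr1n -quat_abs_conj quat_abs_sqr -[quat_conj _]mulr1 qdot_rot//.
by rewrite subrr cos0 sin0 mul0r addr0 /qdot /=; ring.
Qed.

Definition angle (M : nat) (m : 'I_M) (k : int) : R :=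
  2 * pi * (m%:R / M%:R) * k%:~R.

(** Expand the square by [qdot] and sum over m first: the pairs r != s cancel by [sum_root], and
    each diagonal pair counts M times. The offset k drops out of the angle differences. *)
Lemma parseval (M : nat) u (k : int) (F : 'I_M -> quat R) : qunit u ->
  \sum_(m < M) quat_abs
    (\sum_(r < M) quat_conj (quat_expi u (angle M m (k + r%:Z))) * F r) ^+ 2 =
  M%:R * \sum_(r < M) quat_abs (F r) ^+ 2.
Proof.
move=> hu.
under eq_bigr do rewrite quat_abs_sqr qdot_suml.
rewrite exchange_big mulr_sumr /=; apply: eq_bigr => r _.
under eq_bigr do rewrite qdot_sumr.
rewrite exchange_big /= (bigD1 r)//= [X in _ + X]big1 ?addr0 => [|s sr].
  under eq_bigr do rewrite qdot_rot// subrr cos0 sin0 mul1r mul0r addr0.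
  by rewrite sumr_const card_ord quat_abs_sqr mulr_natl.
have diff (m : 'I_M) : angle M m (k + r%:Z) - angle M m (k + s%:Z) =
    2 * pi * (m%:R / M%:R) * (r%:R - s%:R).
  by rewrite /angle !rmorphD /= -!pmulrn; ring.
under eq_bigr do rewrite qdot_rot// diff.
have [cos_sum sin_sum] := @sum_root R M r s.
rewrite big_split -!mulr_suml /= cos_sum sin_sum.
by rewrite eq_sym (negbTE sr) mulr0n !mul0r addr0.
Qed.

(** Conjugating e^{i a} f e^{j b} with f real gives f e^{-j b} e^{-i a}; hence the j factor stands
    on the left. *)
Definition phase (M : nat) (m : 'I_M * 'I_M) (k : Z2) : quat R :=
  quat_conj (quat_expi (quatJ R) (angle M m.2 k.2)) *
  quat_conj (quat_expi (quatI R) (angle M m.1 k.1)).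

Lemma parseval2 (M : nat) (k : Z2) (F : 'I_M * 'I_M -> quat R) :
  \sum_(m : 'I_M * 'I_M) quat_abs
    (\sum_(r : 'I_M * 'I_M) phase M m (residue k r) * F r) ^+ 2 =
  M%:R ^+ 2 * \sum_(r : 'I_M * 'I_M) quat_abs (F r) ^+ 2.
Proof.
(* For fixed m1 the inner sum over r1 is a function of r2 alone, so the outer sum is a j-transform;
   what remains after Parseval in j is an i-transform for each r2. *)
transitivity (\sum_(m1 < M) \sum_(m2 < M) quat_abs (\sum_(r2 < M)
    quat_conj (quat_expi (quatJ R) (angle M m2 (k.2 + r2%:Z))) *
    \sum_(r1 < M) quat_conj (quat_expi (quatI R) (angle M m1 (k.1 + r1%:Z))) *
      F (r1, r2)) ^+ 2).
  rewrite pair_big /=; apply: eq_bigr => -[m1 m2] _ /=.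
  congr (quat_abs _ ^+ 2).
  under [RHS]eq_bigr do rewrite mulr_sumr.
  rewrite exchange_big pair_big /=; apply: eq_bigr => -[r1 r2] _ /=.
  by rewrite mulrA.
under eq_bigr do rewrite (parseval _ _ _ _ qunitJ).
rewrite -mulr_sumr expr2 -mulrA; congr (_ * _).
rewrite exchange_big /=.
under eq_bigr do rewrite (parseval _ _ _ _ qunitI).
rewrite -mulr_sumr exchange_big pair_big /=; congr (_ * _).
by apply: eq_bigr => -[].
Qed.

Lemma phase_period (M : nat) (m : 'I_M * 'I_M) (k p : Z2) :
  phase M m (k + p *+ M) = phase M m k.
Proof.
(* The angle formula divides by M; for M = 0 there is no frequency m. *)
have [M0|M0] := eqVneq M 0%N; first by case: M m M0 => [[[]]|].
have expi u (l : 'I_M) (z w : int) :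
    quat_expi u (angle M l (z + w *+ M)) = quat_expi u (angle M l z).
  have -> : angle M l (z + w *+ M) = angle M l z + 2 * pi * (l%:Z * w)%:~R.
    rewrite /angle !rmorphD rmorphM rmorphMn /= mulrDr -[w%:~R *+ M]mulr_natr.
    by congr (_ + _); field; rewrite pnatr_eq0.
  by rewrite /quat_expi cosD2piz sinD2piz.
by rewrite /phase mulrnZ2 /= !expi.
Qed.
End Quat.

(** * Quaternionic sums, Gabor coefficients and the Gram form *)

Section QuatSums.
Context {R : realType}.
Implicit Types f g h x : Z2 -> quat R.

Definition quat_summable f := summableZ2 (fun k => quat_abs (f k)).

Lemma quat_summable_comp f : quat_summable f ->
  [/\ summableZ2 (@q1 R \o f), summableZ2 (@qi R \o f), summableZ2 (@qj R \o f) &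
      summableZ2 (@qij R \o f)].
Proof.
have le_abs (a b c d t : R) : t ^+ 2 <= a ^+ 2 + b ^+ 2 + c ^+ 2 + d ^+ 2 ->
    `|t| <= `|Num.sqrt (a ^+ 2 + b ^+ 2 + c ^+ 2 + d ^+ 2)|.
  by move=> h; rewrite [leRHS]ger0_norm ?sqrtr_ge0// -sqrtr_sqr ler_wsqrtr.
move=> sf; split; apply: le_summableZ2 sf => k; apply: le_abs;
  have := sqr_ge0 (q1 (f k)); have := sqr_ge0 (qi (f k));
  have := sqr_ge0 (qj (f k)); have := sqr_ge0 (qij (f k)) => /=; lra.
Qed.

Lemma sumZ2_lin4 (c1 c2 c3 c4 : R) (u1 u2 u3 u4 : Z2 -> R) :
  summableZ2 u1 -> summableZ2 u2 -> summableZ2 u3 -> summableZ2 u4 ->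
  sumZ2 (fun k => c1 * u1 k + c2 * u2 k + c3 * u3 k + c4 * u4 k) =
  c1 * sumZ2 u1 + c2 * sumZ2 u2 + c3 * sumZ2 u3 + c4 * sumZ2 u4.
Proof.
move=> s1 s2 s3 s4.
have := summableZ2Z c1 _ s1; have := summableZ2Z c2 _ s2.
have := summableZ2Z c3 _ s3; have := summableZ2Z c4 _ s4 => t4 t3 t2 t1.
have t12 := summableZ2D _ _ t1 t2; have t123 := summableZ2D _ _ t12 t3.
rewrite -(sumZ2Z c1)// -(sumZ2Z c2)// -(sumZ2Z c3)// -(sumZ2Z c4)//.
by rewrite -(sumZ2D _ _ t1 t2) -(sumZ2D _ _ t12 t3) -(sumZ2D _ _ t123 t4).
Qed.

Lemma quat_sumZ2_mull c f : quat_summable f ->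
  quat_sumZ2 (fun k => c * f k) = c * quat_sumZ2 f.
Proof.
move=> /quat_summable_comp[s1 s2 s3 s4]; case: c => c1 ci cj cij.
have lin a1 a2 a3 a4 (u : Z2 -> R) :
    u =1 (fun k => a1 * q1 (f k) + a2 * qi (f k) + a3 * qj (f k) + a4 * qij (f k)) ->
    sumZ2 u = a1 * sumZ2 (@q1 R \o f) + a2 * sumZ2 (@qi R \o f) +
      a3 * sumZ2 (@qj R \o f) + a4 * sumZ2 (@qij R \o f).
  by move=> /funext ->; rewrite (sumZ2_lin4 _ _ _ _ _ _ _ _ s1 s2 s3 s4).
(* The coefficients are the rows of the real 4 by 4 matrix of left multiplication by c. *)
congr Quat => /=.
- by rewrite (lin c1 (- ci) (- cj) (- cij)) => [|k /=]; ring.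
- by rewrite (lin ci c1 (- cij) cj) => [|k /=]; ring.
- by rewrite (lin cj cij c1 (- ci)) => [|k /=]; ring.
- by rewrite (lin cij (- cj) ci c1) => [|k /=]; ring.
Qed.

Lemma quat_sum I (s : seq I) (F : I -> quat R) :
  \sum_(i <- s) F i = Quat (\sum_(i <- s) q1 (F i)) (\sum_(i <- s) qi (F i))
    (\sum_(i <- s) qj (F i)) (\sum_(i <- s) qij (F i)).
Proof.
elim: s => [|i s IH]; first by rewrite !big_nil.
by rewrite !big_cons IH.
Qed.

Lemma quat_sumZ2_residue {M : nat} (hM : (0 < M)%N) k0 f : quat_summable f ->
  quat_sumZ2 f =
  \sum_(r : 'I_M * 'I_M) quat_sumZ2 (fun p => f (residue k0 r + p *+ M)).
Proof.
move=> /quat_summable_comp[s1 s2 s3 s4].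
by rewrite quat_sum; congr Quat; rewrite (sumZ2_residue hM k0).
Qed.

Lemma sqnorm_ge0 f : (0 <= sqnorm f)%E.
Proof. by apply: esum_ge0 => k _; rewrite lee_fin sqr_ge0. Qed.

Lemma sqnorm_shift f c : sqnorm (fun k => f (k - c)) = sqnorm f.
Proof.
rewrite [RHS]/sqnorm (reindex_esum [set: Z2] _ (fun k => k - c))//.
split=> // [a b _ _ /addIr //|k _]; exists (k + c) => //=.
by rewrite addrK.
Qed.

Lemma sqnorm_residue {M : nat} (hM : (0 < M)%N) k0 f :
  sqnorm f =
  (\sum_(r : 'I_M * 'I_M) sqnorm (fun p => f (residue k0 r + p *+ M)%R))%E.
Proof. by apply: (esum_residue hM) => k; rewrite lee_fin sqr_ge0. Qed.

Lemma ell2_residue {M : nat} (hM : (0 < M)%N) k0 f (r : 'I_M * 'I_M) :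
  ell2 f -> ell2 (fun p => f (residue k0 r + p *+ M)).
Proof.
rewrite /ell2 /= (sqnorm_residue hM k0); apply: le_lt_trans.
by rewrite (bigD1 r)//= leeDl// sume_ge0// => s _; exact: sqnorm_ge0.
Qed.

Lemma quat_summableM f g : ell2 f -> ell2 g -> quat_summable (fun k => f k * g k).
Proof.
move=> lf lg; apply: le_lt_trans (lte_add_pinfty lf lg).
rewrite -esumD; try by move=> k _; rewrite lee_fin sqr_ge0.
apply: le_esum => k _; rewrite lee_fin quat_absM normrM !ger0_norm ?quat_abs_ge0//.
(* Expanding this square bounds |f||g| by |f|^2 + |g|^2. *)
have := sqr_ge0 (quat_abs (f k) - quat_abs (g k)).
have := quat_abs_ge0 (f k); have := quat_abs_ge0 (g k).
by nra.
Qed.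

(** A real window commutes with the exponentials, so the phase moves to the far left; it is constant
    on each coset of M Z^2 and leaves the sum over p. *)
Lemma inner_gabor {M : nat} (hM : (0 < M)%N) (L N : nat) (g : 'I_L -> Z2 -> quat R)
    h l m n k0 : ell2_real (g l) -> ell2 h ->
  inner (gabor (M := M) N g l m n) h =
  \sum_(r : 'I_M * 'I_M) phase M m (residue k0 r) *
    Z2apply (Z2tr (gabor_mx M N (g l) (residue k0 r)))
      (fun p => h (residue k0 r + p *+ M)) n.
Proof.
move=> [lg rg] lh.
have lgn : ell2 (fun k => g l (k - n *+ N)) by rewrite /ell2 /= sqnorm_shift.
have integrand k : quat_conj (gabor N g l m n k) * h k =
    phase M m k * (g l (k - n *+ N) * h k).
  rewrite /gabor /modulate /phase /translate; have [t ->] := rg (k - n *+ N).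
  rewrite -!/(angle M _ _).
  by case: (quat_expi _ _) (quat_expi _ _) (h k) => [? ? ? ?] [? ? ? ?] [? ? ? ?];
    congr Quat => /=; ring.
rewrite /inner (funext integrand) (quat_sumZ2_residue hM k0); last first.
  (* The phase has modulus one, so it does not affect summability. *)
  have := quat_summableM _ _ lgn lh; apply: le_summableZ2 => k.
  rewrite quat_absM /phase quat_absM !quat_abs_conj.
  by rewrite (quat_abs_expi _ _ (qunitI)) (quat_abs_expi _ _ (qunitJ)) !mul1r.
apply: eq_bigr => r _; rewrite -quat_sumZ2_mull.
  by congr quat_sumZ2; apply/funext => p; rewrite phase_period.
exact: summableZ2_residue (quat_summableM _ _ lgn lh).
Qed.

Definition gram_form {L : nat} (M N : nat) (g : 'I_L -> Z2 -> quat R) k x : \bar R :=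
  (\sum_(l < L) sqnorm (Z2apply (Z2tr (gabor_mx M N (g l) k)) x))%E.

(** Parseval is applied for each l and n separately; nonnegativity allows the sums to be
    exchanged. *)
Lemma gabor_sum {M : nat} (hM : (0 < M)%N) (L N : nat)
    (g : 'I_L -> Z2 -> quat R) k0 h :
  (forall l, ell2_real (g l)) -> ell2 h ->
  (\sum_(l < L) \esum_(n in [set: Z2]) \sum_(m : 'I_M * 'I_M)
    (quat_abs (inner (gabor N g l m n) h) ^+ 2)%:E =
  (M%:R ^+ 2)%:E * \sum_(r : 'I_M * 'I_M)
    gram_form M N g (residue k0 r) (fun p => h (residue k0 r + p *+ M)%R))%E.
Proof.
move=> hg lh; rewrite /gram_form exchange_big /=.
rewrite ge0_sume_distrr => [|l _]; last by rewrite sume_ge0// => r _; exact: sqnorm_ge0.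
apply: eq_bigr => l _.
rewrite -esum_sum => [|n r _ _]; last by rewrite lee_fin sqr_ge0.
rewrite -esumZl ?sqr_ge0//; last by move=> n _; rewrite sume_ge0// => r _; rewrite lee_fin sqr_ge0.
apply: eq_esum => n _; rewrite !sumEFin -EFinM -(parseval2 M k0); congr (_%:E).
by apply: eq_bigr => m _; rewrite (inner_gabor hM _ _ _ _ _ _ _ k0).
Qed.

(** Column n of the matrix at k + qN is column n - q of the matrix at k, and [sqnorm] is invariant
    under shifts. *)
Lemma gram_form_shift (L M N : nat) (g : 'I_L -> Z2 -> quat R) k q x :
  gram_form M N g (k + q *+ N) x = gram_form M N g k x.
Proof.
apply: eq_bigr => l _; rewrite -[RHS](sqnorm_shift _ q); congr sqnorm.
apply/funext => n; congr quat_sumZ2; apply/funext => p; rewrite /Z2tr /gabor_mx.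
by congr (g l _ * _); rewrite mulrnBl opprB (addrAC k) -!addrA.
Qed.

Lemma gram_form0 (L M N : nat) (g : 'I_L -> Z2 -> quat R) k :
  gram_form M N g k (fun=> 0) = 0%E.
Proof.
rewrite /gram_form big1// => l _; apply: esum1 => n _.
have -> : Z2apply (Z2tr (gabor_mx M N (g l) k)) (fun=> 0) n = 0.
  rewrite /Z2apply; under [X in quat_sumZ2 X]eq_fun do rewrite mulr0.
  have z : sumZ2 (fun=> 0) = 0 :> R.
    have s0 : summableZ2 (fun=> 0 : R).
      by rewrite summableZ2E esum1// => q _; rewrite normr0.
    (* The zero function is 0 times itself, so homogeneity gives the value of its sum. *)
    rewrite -[RHS](mul0r (sumZ2 (fun=> 0))) -sumZ2Z//.
    by congr sumZ2; apply/funext => q; rewrite mul0r.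
  by congr Quat.
by rewrite quat_abs_sqr /qdot /= !mulr0 !addr0.
Qed.
End QuatSums.

(** * Functions supported on a single coset of M Z^2 *)

Section Spread.
Context {R : realType}.

(** Places x on k0 + M Z^2 and extends by zero. For M > 0 the chosen p is unique by
    [residue_bij]. *)
Definition spread (M : nat) (k0 : Z2) (x : Z2 -> quat R) : Z2 -> quat R :=
  fun k => if pselect (exists p, k = k0 + p *+ M) is left e
           then x (projT1 (cid e)) else 0.

Lemma spread_residue {M : nat} (hM : (0 < M)%N) k0 x (r : 'I_M * 'I_M) :
  (fun p => spread M k0 x (residue k0 r + p *+ M)) =
  if r == (Ordinal hM, Ordinal hM) then x else fun=> 0.
Proof.
have [_ inj _] := residue_bij hM k0.
have r0 : residue k0 (Ordinal hM, Ordinal hM) = k0 by rewrite /residue addr0.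
apply/funext => p; rewrite /spread; case: pselect => [e|ne].
  case: cid => q /= eq_q.
  have [-> ->] : (r, p) = ((Ordinal hM, Ordinal hM), q).
    by apply: inj; rewrite ?inE//= r0.
  by rewrite eqxx.
case: eqP => // er; case: ne; exists p.
by rewrite er r0.
Qed.

(** Stated for a general [F] vanishing at the zero function, to serve both the norm and the Gram
    form. *)
Lemma sum_spread {M : nat} (hM : (0 < M)%N) k0 x (F : Z2 -> (Z2 -> quat R) -> \bar R) :
  (forall k, F k (fun=> 0%R) = 0%E) ->
  (\sum_(r : 'I_M * 'I_M)
    F (residue k0 r) (fun p => spread M k0 x (residue k0 r + p *+ M)%R) =
  F k0 x)%E.
Proof.
move=> F0; rewrite (bigD1 (Ordinal hM, Ordinal hM))//= big1 => [|r /negbTE rn].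
  by rewrite adde0 spread_residue eqxx /residue addr0.
by rewrite spread_residue rn F0.
Qed.

Lemma sqnorm0 : sqnorm (fun=> 0 : quat R) = 0%E.
Proof.
by apply: esum1 => k _; rewrite quat_abs_sqr /qdot /= !mulr0 !addr0.
Qed.

Lemma sqnorm_spread {M : nat} (hM : (0 < M)%N) k0 x :
  sqnorm (spread M k0 x) = sqnorm x.
Proof.
rewrite (sqnorm_residue hM k0).
exact: (sum_spread hM k0 x (fun=> @sqnorm R) (fun=> sqnorm0)).
Qed.
End Spread.

Theorem theorem1 (R : realType) (L M N : nat)
    (hL : (0 < L)%N) (hM : (0 < M)%N) (hN : (0 < N)%N)
    (g : 'I_L -> Z2 -> quat R) (hg : forall l : 'I_L, ell2_real (g l))
    (A B : R) (hA : 0 < A) (hAB : A <= B) :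
  let statement1 := gabor_frame M N g A B in
  let statement2 := forall k : Z2,
    gram_bounds (fun l : 'I_L => gabor_mx M N (g l) k)
      (A / M%:R ^+ 2) (B / M%:R ^+ 2) in
  let statement3 := forall k : 'I_N * 'I_N,
    gram_bounds (fun l : 'I_L => gabor_mx M N (g l) (k.1%:Z, k.2%:Z))
      (A / M%:R ^+ 2) (B / M%:R ^+ 2) in
  (statement1 <-> statement2) /\ (statement2 <-> statement3).
Proof.
move=> statement1 statement2 statement3.
have M2 : 0 < M%:R ^+ 2 :> R by rewrite exprn_gt0// ltr0n.
have divM (C : R) (s : \bar R) :
    ((C / M%:R ^+ 2)%:E * s)%E = ((M%:R ^+ 2)^-1%:E * (C%:E * s))%E.
  by rewrite mulrC EFinM muleA.
split; split.
- move=> [_ _ frame] k x lx.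
  (* The frame inequality is tested on x spread over k + M Z^2. With base point k only the residue
     (0, 0) contributes, leaving M^2 times the Gram form at k. *)
  have lh : ell2 (spread M k x) by rewrite /ell2 /= sqnorm_spread.
  have [lo up] := frame _ lh; move: lo up.
  rewrite (gabor_sum hM _ _ _ k)// sqnorm_spread//.
  rewrite (sum_spread hM k x (gram_form M N g) (gram_form0 L M N g)).
  by move=> lo up S; rewrite !divM lee_pdivrMl// lee_pdivlMl.
- move=> gram; split=> // h lh.
  (* Any base point would do; with 0, the norm and the frame sum split over the same residues and
     are compared term by term. *)
  cbv zeta; rewrite (gabor_sum hM _ _ _ 0)// (sqnorm_residue hM 0 h).
  rewrite -(lee_pdivrMl _ _ M2) -(lee_pdivlMl _ _ M2) -!divM.
  rewrite !ge0_sume_distrr; try by move=> r _; exact: sqnorm_ge0.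
  by split; apply: lee_sum => r _;
    have [] := gram (residue 0 r) _ (ell2_residue hM 0 h r lh).
- by move=> gram k; exact: gram.
- move=> gram k x lx.
  (* Reduce k modulo N in each coordinate; the quotient (q1, q2) is absorbed by the N-periodicity of
     the Gram form. *)
  have [r1 [q1 e1]] := residue_int hN k.1.
  have [r2 [q2 e2]] := residue_int hN k.2.
  have -> : k = (r1%:Z, r2%:Z) + (q1, q2) *+ N.
    by rewrite mulrnZ2 [LHS]surjective_pairing e1 e2.
  rewrite -/(gram_form M N g _ x) gram_form_shift.
  exact: (gram (r1, r2)).
Qed.
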